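(* Let $0<\alpha<1$, let $A$ be a strictly positive continuous function, and fix a left state $U_-=(\rho_-,u_-,v_-)$, $\rho_->0$. For a right state $U=(\rho,u,v)$, $\rho>0$, the $\delta$-shock connecting $U_-$ to $U$, with speed $c=\sigma_+$ if $\rho\neq\rho_-$ and $c=\sigma_0$ if $\rho=\rho_-$, is overcompressive, i.e. $\lambda_3(U)\le c\le\lambda_1(U_-)$, if and only if one of the following holds: $$\rho<\Big(\frac{A(v)}{A(v_-)}\Big)^{1/\alpha}\rho_-\quad\text{and}\quad u\le u_--\sqrt{\frac{\alpha A(v_-)}{\rho_-^{\alpha+1}}}-\frac1{\sqrt\rho}\sqrt{\frac{(\alpha-1)A(v_-)}{\rho_-^\alpha}+\frac{A(v)}{\rho^\alpha}},$$ or $$\rho\ge\Big(\frac{A(v)}{A(v_-)}\Big)^{1/\alpha}\rho_-\quad\text{and}\quad u\le u_--\sqrt{\frac{\alpha A(v)}{\rho^{\alpha+1}}}-\frac1{\sqrt{\rho_-}}\sqrt{\frac{(\alpha-1)A(v)}{\rho^\alpha}+\frac{A(v_-)}{\rho_-^\alpha}}.$$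
   Context: System: $\rho_t+(\rho u)_x=0$, $(\rho u)_t+(\rho u^2-A(v)\rho^{-\alpha})_x=0$, $(\rho v)_t+(\rho uv)_x=0$, $\rho>0$, with $\lambda_1(U)=u-\sqrt{\alpha A(v)\rho^{-\alpha-1}}$ and $\lambda_3(U)=u+\sqrt{\alpha A(v)\rho^{-\alpha-1}}$. With $[\cdot]$ the jump (value at $U$ minus value at $U_-$), $$\sigma_+=\frac{[\rho u]+\sqrt\Delta}{[\rho]},\quad \Delta=[\rho u]^2-[\rho]\Big[\rho u^2-\frac{A(v)}{\rho^\alpha}\Big],\qquad \sigma_0=\frac{[\rho u^2-A(v)\rho^{-\alpha}]}{2[\rho u]}.$$ The $\delta$-shock is considered overcompressive only if $c$ is a well-defined real number ($\Delta\ge0$ if $[\rho]\ne0$; $[\rho u]\neq0$ if $[\rho]=0$). *)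

(* Defs.v *)
From Stdlib Require Import Reals.
Open Scope R_scope.

Record state := State { rho : R; vel : R; var : R }.

Section System.

Variables (alpha : R) (A : R -> R).

(** Real powers of the density are [Rpower], which is the usual power
    because densities are positive. *)
Definition pressure_term (U : state) : R :=
  A (var U) * Rpower (rho U) (- alpha).

Definition momentum (U : state) : R := rho U * vel U.

Definition momentum_flux (U : state) : R :=
  rho U * vel U ^ 2 - pressure_term U.

Definition lambda1 (U : state) : R :=
  vel U - sqrt (alpha * A (var U) * Rpower (rho U) (- alpha - 1)).

Definition lambda3 (U : state) : R :=
  vel U + sqrt (alpha * A (var U) * Rpower (rho U) (- alpha - 1)).

Definition jump (f : state -> R) (Um U : state) : R := f U - f Um.

Definition Delta (Um U : state) : R :=
  jump momentum Um U ^ 2 - jump rho Um U * jump momentum_flux Um U.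

Definition sigma_plus (Um U : state) : R :=
  (jump momentum Um U + sqrt (Delta Um U)) / jump rho Um U.

Definition sigma_zero (Um U : state) : R :=
  jump momentum_flux Um U / (2 * jump momentum Um U).

Definition delta_shock_speed (Um U : state) : R :=
  if Req_EM_T (rho U) (rho Um) then sigma_zero Um U else sigma_plus Um U.

(** [sqrt] and [/] are total, so that the speed is a genuine real number has
    to be required separately. *)
Definition speed_well_defined (Um U : state) : Prop :=
  (jump rho Um U <> 0 -> 0 <= Delta Um U) /\
  (jump rho Um U = 0 -> jump momentum Um U <> 0).

Definition overcompressive (Um U : state) : Prop :=
  speed_well_defined Um U /\
  lambda3 U <= delta_shock_speed Um U <= lambda1 Um.

End System.

(* Main.v *)
Require Import Defs.
From Stdlib Require Import Reals Lra Psatz.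
Open Scope R_scope.

(** Write [a], [b] for the left and right densities, [p], [q] for the left and
    right values of [A(v) / rho ^ alpha], and measure the shock speed [c] from
    both sides: [s = c - u], [t = um - c], so that [s + t = um - u].

    The formulas for [c] say that it is a root of the quadratic
    [b * s ^ 2 - q = a * t ^ 2 - p] ([shock_speed_quadratic]), and the choice
    of the root is expressed by [0 <= b * s + a * t]: for [a <> b] this linear
    form is the square root of the discriminant.  Overcompressivity reads [s >= sqrt (alpha * q / b)] and
    [t >= sqrt (alpha * p / a)].  When [p <= q], the quadratic makes the second
    inequality imply the first, and even [b * s ^ 2 >= (alpha - 1) * p + q].
    Adding the two sharp bounds gives a lower bound on [s + t = um - u], which
    is the first alternative of the theorem; conversely, that bound forces
    [t] to be large on the chosen branch of the quadratic
    ([overcompressive_iff_gap]).  The case [q <= p] is the same statement with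
    the two sides exchanged, since the quadratic and the branch condition are
    symmetric under [(s, b, q) <-> (t, a, p)].  Finally [p < q] is the stated
    condition on [rho] ([density_threshold]). *)

(** * The shock speed relative to the two states *)

(** The least velocity gap [um - u] for an overcompressive shock, when
    [p <= q]: the sum of the sharp lower bounds on [t] and on [s]. *)
Definition gap (alpha a b p q : R) : R :=
  sqrt (alpha * p / a) + sqrt (((alpha - 1) * p + q) / b).

Lemma le_sqrt_of_sq x y : 0 <= x -> y <= x ^ 2 -> sqrt y <= x.
Proof.
  intros Hx H. rewrite <- (sqrt_pow2 x Hx). now apply sqrt_le_1_alt.
Qed.

Lemma sqrt_div_sq a x : 0 < a -> 0 <= x -> a * sqrt (x / a) ^ 2 = x.
Proof.
  intros Ha Hx.
  rewrite pow2_sqrt by (apply Rmult_le_pos; [| left; apply Rinv_0_lt_compat]; lra).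
  field; lra.
Qed.

Lemma gap_pos alpha a b p q :
  0 < alpha -> 0 < a -> 0 < p -> 0 < gap alpha a b p q.
Proof.
  intros Hal Ha Hp. unfold gap.
  assert (H : 0 < sqrt (alpha * p / a)).
  { apply sqrt_lt_R0. apply Rdiv_lt_0_compat; [apply Rmult_lt_0_compat |]; lra. }
  pose proof (sqrt_pos (((alpha - 1) * p + q) / b)). lra.
Qed.

(** The second summand of the gap alone already exceeds the root of
    [(q - p) / b], which is all that the discriminant needs. *)
Lemma gap_sq alpha a b p q w :
  0 < alpha < 1 -> 0 < a -> 0 < b -> 0 < p <= q ->
  gap alpha a b p q <= w -> q - p < b * w ^ 2.
Proof.
  intros Hal Ha Hb Hpq Hw. unfold gap in Hw.
  assert (Hnn : 0 < alpha * p) by (apply Rmult_lt_0_compat; lra).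
  pose proof (sqrt_div_sq b ((alpha - 1) * p + q) Hb ltac:(lra)) as Hs.
  pose proof (sqrt_pos (((alpha - 1) * p + q) / b)).
  pose proof (sqrt_pos (alpha * p / a)).
  set (s1 := sqrt (((alpha - 1) * p + q) / b)) in *.
  assert (s1 ^ 2 <= w ^ 2) by (apply pow_incr; lra).
  nra.
Qed.

Lemma discriminant_nonneg alpha a b p q w :
  0 < alpha < 1 -> 0 < a -> 0 < b -> 0 < p <= q ->
  gap alpha a b p q <= w -> 0 <= a * b * w ^ 2 + (b - a) * (q - p).
Proof.
  intros Hal Ha Hb Hpq Hw.
  pose proof (gap_sq _ _ _ _ _ _ Hal Ha Hb Hpq Hw). nra.
Qed.

(** The converse direction is where the choice of root matters: if [t] were
    below its bound, then [s] would exceed its own, and the quadratic would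
    force [t < 0].  On the branch [0 <= b * s + a * t] a negative [t] gives
    [b * s ^ 2 - a * t ^ 2 >= b * (s + t) ^ 2], which is more than [q - p]. *)
Lemma overcompressive_iff_gap alpha a b p q s t :
  0 < alpha < 1 -> 0 < a -> 0 < b -> 0 < p <= q ->
  b * s ^ 2 - q = a * t ^ 2 - p ->
  (0 < s + t -> 0 <= b * s + a * t) ->
  (sqrt (alpha * q / b) <= s /\ sqrt (alpha * p / a) <= t <->
   gap alpha a b p q <= s + t).
Proof.
  intros Hal Ha Hb Hpq Hquad Hbranch.
  assert (Hp : 0 < alpha * p) by (apply Rmult_lt_0_compat; lra).
  assert (Hq : 0 < alpha * q) by (apply Rmult_lt_0_compat; lra).
  assert (Hpq' : alpha * q <= (alpha - 1) * p + q) by nra.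
  pose proof (sqrt_div_sq a (alpha * p) Ha ltac:(lra)) as Ht0.
  pose proof (sqrt_div_sq b ((alpha - 1) * p + q) Hb ltac:(lra)) as Hs1.
  pose proof (sqrt_pos (alpha * p / a)) as Ht0p.
  pose proof (sqrt_pos (((alpha - 1) * p + q) / b)) as Hs1p.
  assert (Hs01 : sqrt (alpha * q / b) <= sqrt (((alpha - 1) * p + q) / b)).
  { apply sqrt_le_1_alt. apply Rmult_le_compat_r; [| lra].
    left; now apply Rinv_0_lt_compat. }
  pose proof (gap_pos alpha a b p q ltac:(lra) Ha ltac:(lra)) as Hgap.
  (* The quadratic turns the bound on [t] into the sharp bound on [s]. *)
  assert (Hkey : 0 <= s -> sqrt (alpha * p / a) <= t ->
                 sqrt (((alpha - 1) * p + q) / b) <= s).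
  { intros Hs Ht. apply le_sqrt_of_sq; [exact Hs |].
    apply Rmult_le_reg_l with b; [exact Hb |].
    replace (b * (((alpha - 1) * p + q) / b)) with ((alpha - 1) * p + q)
      by (field; lra).
    assert (sqrt (alpha * p / a) ^ 2 <= t ^ 2) by (apply pow_incr; lra).
    nra. }
  split.
  - intros [Hs Ht]. unfold gap.
    pose proof (sqrt_pos (alpha * q / b)).
    pose proof (Hkey ltac:(lra) Ht). lra.
  - intros Hw.
    pose proof (gap_sq _ _ _ _ _ _ Hal Ha Hb Hpq Hw) as Hsq.
    specialize (Hbranch ltac:(lra)).
    unfold gap in Hw, Hgap.
    set (t0 := sqrt (alpha * p / a)) in *.
    set (s1 := sqrt (((alpha - 1) * p + q) / b)) in *.
    assert (Ht : t0 <= t).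
    { destruct (Rle_lt_dec t0 t) as [| Hlt]; [assumption | exfalso].
      assert (Hss : s1 ^ 2 < s ^ 2) by nra.
      assert (Htt : t0 ^ 2 < t ^ 2) by nra.
      assert (Htneg : t < 0) by nra.
      assert (b * s ^ 2 - a * t ^ 2 - b * (s + t) ^ 2
              = - t * (b * (s + t) + (b * s + a * t))) by ring.
      assert (0 <= - t * (b * (s + t) + (b * s + a * t))).
      { apply Rmult_le_pos; [lra |].
        apply Rplus_le_le_0_compat; [apply Rmult_le_pos; lra | exact Hbranch]. }
      lra. }
    split; [| exact Ht].
    (* With the sides exchanged, [s < 0] on this branch would give
       [a * t ^ 2 - b * s ^ 2 >= a * (s + t) ^ 2 > 0 >= p - q]. *)
    assert (0 <= s); [| pose proof (Hkey ltac:(assumption) Ht); lra].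
    destruct (Rle_lt_dec 0 s) as [| Hneg]; [assumption | exfalso].
    assert (b * s ^ 2 - a * t ^ 2 + a * (s + t) ^ 2
            = s * (a * (s + t) + (b * s + a * t))) by ring.
    assert (0 <= - s * (a * (s + t) + (b * s + a * t))).
    { apply Rmult_le_pos; [lra |].
      apply Rplus_le_le_0_compat; [apply Rmult_le_pos; lra | exact Hbranch]. }
    assert (0 < a * (s + t) ^ 2) by (apply Rmult_lt_0_compat; nra).
    lra.
Qed.

(** * From the system to the normalized quantities *)

Section Normalized.

Variables (alpha : R) (A : R -> R).

Lemma Delta_eq Um U :
  Defs.Delta alpha A Um U =
  rho Um * rho U * (vel Um - vel U) ^ 2 +
  (rho U - rho Um) * (pressure_term alpha A U - pressure_term alpha A Um).
Proof. unfold Defs.Delta, jump, momentum_flux, momentum. ring. Qed.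

Lemma speed_well_defined_iff Um U : 0 < rho Um ->
  speed_well_defined alpha A Um U <->
  (rho U <> rho Um ->
     0 <= rho Um * rho U * (vel Um - vel U) ^ 2 +
       (rho U - rho Um) *
       (pressure_term alpha A U - pressure_term alpha A Um)) /\
  (rho U = rho Um -> vel Um <> vel U).
Proof.
  intros Hm. unfold speed_well_defined. rewrite Delta_eq.
  unfold jump, momentum. split; intros [H1 H2]; split; intros H.
  - apply H1; lra.
  - specialize (H2 ltac:(lra)). intros E. apply H2. rewrite H, E. ring.
  - apply H1; lra.
  - intros E. assert (Heq : rho U = rho Um) by lra.
    apply (H2 Heq). rewrite Heq in E. nra.
Qed.

(** Both formulas for the speed solve
    [jump rho * c ^ 2 - 2 * jump momentum * c + jump momentum_flux = 0], which
    is linear in [c] for equal densities; collecting the terms of each state into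
    a square gives the first conclusion.  For [rho U <> rho Um] the linear form in the second conclusion is
    [sqrt Delta], and for equal densities it is [rho Um * (vel Um - vel U)]. *)
Lemma shock_speed_quadratic Um U :
  0 < rho Um -> speed_well_defined alpha A Um U ->
  let c := delta_shock_speed alpha A Um U in
  rho U * (c - vel U) ^ 2 - pressure_term alpha A U
  = rho Um * (vel Um - c) ^ 2 - pressure_term alpha A Um /\
  (0 < vel Um - vel U ->
   0 <= rho U * (c - vel U) + rho Um * (vel Um - c)).
Proof.
  intros Hm Hwd c. subst c.
  apply speed_well_defined_iff in Hwd; [| exact Hm]. destruct Hwd as [H1 H2].
  unfold delta_shock_speed. destruct (Req_EM_T (rho U) (rho Um)) as [E | E].
  - specialize (H2 E).
    unfold sigma_zero, jump, momentum_flux, momentum. rewrite E. split.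
    + field. replace (rho Um * vel U - rho Um * vel Um)
        with (rho Um * (vel U - vel Um)) by ring.
      intros H. apply Rmult_integral in H. lra.
    + intros Hw.
      match goal with |- 0 <= ?x => replace x with (rho Um * (vel Um - vel U)) by ring end.
      apply Rmult_le_pos; lra.
  - specialize (H1 E). rewrite <- Delta_eq in H1.
    pose proof (pow2_sqrt _ H1) as Hsq. pose proof (sqrt_pos (Defs.Delta alpha A Um U)).
    assert (Hlin : rho U * (sigma_plus alpha A Um U - vel U)
                   + rho Um * (vel Um - sigma_plus alpha A Um U)
                   = sqrt (Defs.Delta alpha A Um U)).
    { unfold sigma_plus, jump, momentum. field. lra. }
    split; [| intros _; lra].
    rewrite <- Hlin, Delta_eq in Hsq.
    apply Rmult_eq_reg_l with (rho U - rho Um); [| lra].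
    nra.
Qed.

Lemma pressure_term_pos U :
  (forall w, 0 < A w) -> 0 < pressure_term alpha A U.
Proof.
  intros HA. apply Rmult_lt_0_compat; [apply HA | apply exp_pos].
Qed.

Lemma pressure_term_div U :
  pressure_term alpha A U = A (var U) / Rpower (rho U) alpha.
Proof. unfold pressure_term. now rewrite Rpower_Ropp. Qed.

Lemma sound_speed_sq U : 0 < rho U ->
  alpha * A (var U) * Rpower (rho U) (- alpha - 1)
  = alpha * pressure_term alpha A U / rho U.
Proof.
  intros H. unfold pressure_term.
  replace (- alpha - 1) with (- alpha + - (1)) by ring.
  rewrite Rpower_plus, (Rpower_Ropp _ 1), Rpower_1 by exact H. field; lra.
Qed.

Lemma overcompressive_normalized Um U : 0 < rho Um -> 0 < rho U ->
  let c := delta_shock_speed alpha A Um U in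
  overcompressive alpha A Um U <->
  speed_well_defined alpha A Um U /\
  sqrt (alpha * pressure_term alpha A U / rho U) <= c - vel U /\
  sqrt (alpha * pressure_term alpha A Um / rho Um) <= vel Um - c.
Proof.
  intros Hm H c. subst c. unfold overcompressive, lambda1, lambda3.
  rewrite !sound_speed_sq by assumption.
  split; intros [Hw Hc]; split; try exact Hw; lra.
Qed.

Lemma well_defined_of_gap Um U :
  0 < alpha < 1 -> (forall w, 0 < A w) -> 0 < rho Um -> 0 < rho U ->
  let p := pressure_term alpha A Um in
  let q := pressure_term alpha A U in
  (p <= q /\ gap alpha (rho Um) (rho U) p q <= vel Um - vel U) \/
  (q <= p /\ gap alpha (rho U) (rho Um) q p <= vel Um - vel U) ->
  speed_well_defined alpha A Um U.
Proof.
  intros Hal HA Hm H p q Hgap.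
  pose proof (pressure_term_pos Um HA) as Hp. fold p in Hp.
  pose proof (pressure_term_pos U HA) as Hq. fold q in Hq.
  apply speed_well_defined_iff; [exact Hm |]. fold p q.
  destruct Hgap as [[Hpq Hw] | [Hpq Hw]]; split; intros _.
  - apply (discriminant_nonneg alpha); auto.
  - pose proof (gap_pos alpha (rho Um) (rho U) p q). lra.
  - pose proof (discriminant_nonneg alpha _ _ _ _ _ Hal H Hm (conj Hq Hpq) Hw).
    lra.
  - pose proof (gap_pos alpha (rho U) (rho Um) q p). lra.
Qed.

Lemma overcompressive_iff_cases Um U :
  0 < alpha < 1 -> (forall w, 0 < A w) -> 0 < rho Um -> 0 < rho U ->
  let p := pressure_term alpha A Um in
  let q := pressure_term alpha A U in
  overcompressive alpha A Um U <->
  (p < q /\ gap alpha (rho Um) (rho U) p q <= vel Um - vel U) \/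
  (q <= p /\ gap alpha (rho U) (rho Um) q p <= vel Um - vel U).
Proof.
  intros Hal HA Hm H p q.
  pose proof (pressure_term_pos Um HA) as Hp. fold p in Hp.
  pose proof (pressure_term_pos U HA) as Hq. fold q in Hq.
  rewrite overcompressive_normalized by assumption. fold p q.
  assert (Hred : speed_well_defined alpha A Um U ->
    let c := delta_shock_speed alpha A Um U in
    (sqrt (alpha * q / rho U) <= c - vel U /\
     sqrt (alpha * p / rho Um) <= vel Um - c <->
     (p < q /\ gap alpha (rho Um) (rho U) p q <= vel Um - vel U) \/
     (q <= p /\ gap alpha (rho U) (rho Um) q p <= vel Um - vel U))).
  { intros Hwd c.
    destruct (shock_speed_quadratic Um U Hm Hwd) as [Hquad Hbranch].
    fold c p q in Hquad, Hbranch.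
    replace (vel Um - vel U) with ((c - vel U) + (vel Um - c)) in * by ring.
    destruct (Rlt_le_dec p q) as [Hpq | Hpq].
    - rewrite (overcompressive_iff_gap alpha (rho Um) (rho U) p q)
        by (assumption || lra).
      intuition lra.
    - rewrite and_comm,
        (overcompressive_iff_gap alpha (rho U) (rho Um) q p),
        (Rplus_comm (vel Um - c)) by (assumption || lra).
      intuition lra. }
  split.
  - intros [Hwd Hc]. now apply Hred.
  - intros Hc. assert (Hwd : speed_well_defined alpha A Um U).
    { apply well_defined_of_gap; auto. fold p q. intuition lra. }
    split; [exact Hwd | now apply Hred].
Qed.

(** Raising to the power [alpha] is increasing, so the density threshold
    compares [A(v) / rho ^ alpha] on the two sides. *)
Lemma density_threshold Um U :
  0 < alpha -> (forall w, 0 < A w) -> 0 < rho Um -> 0 < rho U ->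
  rho U < Rpower (A (var U) / A (var Um)) (1 / alpha) * rho Um <->
  pressure_term alpha A Um < pressure_term alpha A U.
Proof.
  intros Hal HA Hm H.
  pose proof (HA (var U)) as HU. pose proof (HA (var Um)) as HUm.
  set (r := Rpower (A (var U) / A (var Um)) (1 / alpha) * rho Um).
  assert (Hr : 0 < r) by (apply Rmult_lt_0_compat; [apply exp_pos | exact Hm]).
  assert (Hpow : Rpower r alpha
                 = A (var U) / A (var Um) * Rpower (rho Um) alpha).
  { unfold r. rewrite <- Rpower_mult_distr, Rpower_mult;
      [| apply exp_pos | exact Hm].
    replace (1 / alpha * alpha) with 1 by (field; lra).
    rewrite Rpower_1; [reflexivity | now apply Rdiv_lt_0_compat]. }
  rewrite !pressure_term_div.
  set (x := Rpower (rho U) alpha). set (y := Rpower (rho Um) alpha).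
  assert (Hx : 0 < x) by apply exp_pos. assert (Hy : 0 < y) by apply exp_pos.
  fold y in Hpow.
  assert (Hxr : A (var U) / x - A (var Um) / y
                = A (var Um) / (x * y) * (Rpower r alpha - x)).
  { rewrite Hpow. field. lra. }
  assert (Hk : 0 < A (var Um) / (x * y))
    by (apply Rdiv_lt_0_compat; [lra | now apply Rmult_lt_0_compat]).
  split; intros Hlt.
  - assert (x < Rpower r alpha) by (apply Rlt_Rpower_l; lra). nra.
  - destruct (Rlt_le_dec (rho U) r) as [| Hle]; [assumption | exfalso].
    assert (Rpower r alpha <= x) by (apply Rle_Rpower_l; lra). nra.
Qed.

Lemma gap_explicit Um U : 0 < rho Um -> 0 < rho U ->
  gap alpha (rho Um) (rho U)
    (pressure_term alpha A Um) (pressure_term alpha A U)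
  = sqrt (alpha * A (var Um) / Rpower (rho Um) (alpha + 1))
    + 1 / sqrt (rho U) *
      sqrt ((alpha - 1) * A (var Um) / Rpower (rho Um) alpha
            + A (var U) / Rpower (rho U) alpha).
Proof.
  intros Hm H. unfold gap. rewrite !pressure_term_div.
  pose proof (exp_pos (alpha * ln (rho Um))) as Hy.
  change (0 < Rpower (rho Um) alpha) in Hy.
  f_equal.
  - f_equal. rewrite Rpower_plus, Rpower_1 by exact Hm. field. lra.
  - rewrite sqrt_div_alt by exact H.
    replace ((alpha - 1) * (A (var Um) / Rpower (rho Um) alpha))
      with ((alpha - 1) * A (var Um) / Rpower (rho Um) alpha) by (field; lra).
    pose proof (sqrt_lt_R0 _ H). field. lra.
Qed.

End Normalized.

Theorem mainTheorem5 (alpha : R) (A : R -> R)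
  (Halpha : 0 < alpha < 1)
  (HApos : forall w : R, 0 < A w)
  (HAcont : continuity A)
  (rhom um vm : R) (Hrhom : 0 < rhom)
  (rho u v : R) (Hrho : 0 < rho) :
  overcompressive alpha A (State rhom um vm) (State rho u v) <->
  (rho < Rpower (A v / A vm) (1 / alpha) * rhom /\
   u <= um - sqrt (alpha * A vm / Rpower rhom (alpha + 1))
        - 1 / sqrt rho *
          sqrt ((alpha - 1) * A vm / Rpower rhom alpha
                + A v / Rpower rho alpha))
  \/
  (rho >= Rpower (A v / A vm) (1 / alpha) * rhom /\
   u <= um - sqrt (alpha * A v / Rpower rho (alpha + 1))
        - 1 / sqrt rhom *
          sqrt ((alpha - 1) * A v / Rpower rho alpha
                + A vm / Rpower rhom alpha)).
Proof.
  rewrite overcompressive_iff_cases by assumption.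
  pose proof (density_threshold alpha A (State rhom um vm) (State rho u v)
                ltac:(lra) HApos Hrhom Hrho) as Hthr.
  rewrite (gap_explicit alpha A (State rhom um vm)),
    (gap_explicit alpha A (State rho u v)) by assumption.
  cbn [Defs.rho vel var] in *.
  split; (intros [[H1 H2] | [H1 H2]]; [left | right]; (split; [| lra])).
  - now apply Hthr.
  - apply Rnot_lt_ge. intros H. apply Hthr in H. lra.
  - now apply Hthr.
  - apply Rnot_lt_le. intros H. apply Hthr in H. lra.
Qed.
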